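(* Let $r\ge3$ be an integer and $t=e^{\pi i/(2r)}$. Let $\mathcal A_r$ be the algebra of quantum observables, i.e. the complex vector space of functions on the character variety of the torus spanned by the symbols $C(p,q)$, $p,q\in\mathbb Z$ (as defined in the context), with the $*$-product $$C(m,n)*C(p,q)=t^{mq-np}C(m+p,n+q)+t^{-(mq-np)}C(m-p,n-q).$$ Let $A$ be the noncommutative torus generated by unitaries $U,V$ with $UV=t^2VU$ (which has rational rotation angle). Then the linear map determined by $$C(p,q)\longmapsto t^{-pq}\left(U^pV^q+U^{-p}V^{-q}\right),\qquad p,q\in\mathbb Z,$$ is an injective algebra homomorphism from $\mathcal A_r$ to $A$; thus $\mathcal A_r$ is isomorphic to a subalgebra of the noncommutative torus.
   Context: The moduli space of flat $SU(2)$-connections on the torus (equivalently the $SU(2)$-character variety of the fundamental group of the torus) is the quotient of $\mathbb R^2=\mathbb C$ by the lattice $\mathbb Z[i]$ and by the symmetry with respect to the origin. The algebra of observables is (densely) spanned by the functions $2\cos 2\pi(px+qy)$, $p,q\in\mathbb Z$, on this space. In the $*$-product algebra $\mathcal A_r$ the element $C(p,q)$ stands for the function $2\cos2\pi(px+qy)$; so $C(p,q)=C(-p,-q)$, $C(0,0)=2$ (twice the unit), and $\mathcal A_r$ is the linear span of these functions with the deformed bilinear product $*$ given in the claim in place of the pointwise product. This product is the one induced by the product-to-sum formula satisfied by the operators quantizing these functions. The noncommutative torus $A$ is the universal $C^*$-algebra generated by two unitaries $U,V$ (with inverses $U^{-1},V^{-1}$) subject to $UV=t^2VU$. *)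

(* Defs.v *)
From HB Require Import structures.
From mathcomp Require Import all_boot all_order all_algebra.
From mathcomp Require Import complex ring.
From mathcomp Require Import all_classical all_reals all_analysis.

Set Implicit Arguments.
Unset Strict Implicit.
Unset Printing Implicit Defensive.

Import Order.TTheory GRing.Theory Num.Theory.

Local Open Scope ring_scope.
Local Open Scope complex_scope.
Local Open Scope quotient_scope.

Definition expi (R : realType) (x : R) : R[i] := cos x +i* sin x.

Definition tpar (R : realType) (r : nat) : R[i] := expi (pi / (2 * r%:R) : R).

Section ExpiTheory.
Variable R : realType.
Implicit Types x y : R.

Lemma expi0 : expi (0 : R) = 1.
Proof. by rewrite /expi cos0 sin0. Qed.

Lemma expiD x y : expi (x + y) = expi x * expi y.
Proof. by apply/eqP; rewrite eq_complex /= cosD sinD eqxx /= addrC eqxx. Qed.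

Lemma expiN x : expi (- x) = (expi x)^-1.
Proof.
have e1 : expi (- x) * expi x = 1 by rewrite -expiD addNr expi0.
have ex0 : expi x != 0 by apply: contra_eq_neq e1 => ->; rewrite mulr0 eq_sym oner_eq0.
by apply: (mulIf ex0); rewrite e1 mulVf.
Qed.

Lemma expi_int x (n : int) : expi x ^ n = expi (n%:~R * x).
Proof.
have expi_nat k : expi x ^+ k = expi (k%:R * x).
  elim: k => [|k IHk]; first by rewrite mul0r expi0.
  by rewrite exprS IHk -expiD -[in RHS]natr1 mulrDl mul1r addrC.
case: n => n; first by rewrite -exprnP expi_nat.
by rewrite NegzE -exprnN expi_nat -expiN mulrNz mulNr.
Qed.

Lemma cos_expi x : (2 * cos x)%:C = expi x + expi (- x).
Proof. by apply/eqP; rewrite eq_complex /= cosN sinN subrr mulr2n mulrDl mul1r !eqxx. Qed.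

Lemma tpar_neq0 r : tpar R r != 0.
Proof.
apply/negP => /eqP t0; have /eqP := expiD (pi / (2 * r%:R) : R) (- (pi / (2 * r%:R))).
by rewrite subrr expi0 -/(tpar R r) t0 mul0r oner_eq0.
Qed.

End ExpiTheory.

(* The character variety of the torus: the plane modulo the group generated by
   the translations by Z^2 and the symmetry with respect to the origin. *)
Section CharacterVariety.
Variable R : realType.

Definition charvar_rel (u v : R * R) : bool :=
  `[< exists m n : int,
        v = (u.1 + m%:~R, u.2 + n%:~R) \/ v = (- u.1 + m%:~R, - u.2 + n%:~R) >].

Lemma charvar_rel_refl : reflexive charvar_rel.
Proof. by case=> x y; apply/asboolP; exists 0, 0; left; rewrite /= !addr0. Qed.

Lemma charvar_rel_sym : symmetric charvar_rel.
Proof.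
suff H u v : charvar_rel u v -> charvar_rel v u by move=> u v; apply/idP/idP; exact: H.
case: u => x y /asboolP[m [n [->|->]]]; apply/asboolP.
  by exists (- m), (- n); left; rewrite /= !mulrNz !addrK.
by exists m, n; right; rewrite /= !opprD !opprK !addrNK.
Qed.

Lemma charvar_rel_trans : transitive charvar_rel.
Proof.
move=> v u w /asboolP[m [n H]] /asboolP[m' [n' H']]; apply/asboolP.
case: H H' => -> [] ->.
- by exists (m + m'), (n + n'); left; rewrite /= !intrD !addrA.
- exists (m' - m), (n' - n); right; rewrite /= !intrD !mulrNz.
  by congr pair; ring.
- by exists (m + m'), (n + n'); right; rewrite /= !intrD !addrA.
- exists (m' - m), (n' - n); left; rewrite /= !intrD !mulrNz.
  by congr pair; ring.
Qed.

Canonical charvar_equiv :=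
  EquivRel charvar_rel charvar_rel_refl charvar_rel_sym charvar_rel_trans.

Definition charvar := {eq_quot charvar_equiv}.

Definition cosfun (a : int * int) : charvar -> R[i] := fun z =>
  (2 * cos (2 * pi * (a.1%:~R * (repr z).1 + a.2%:~R * (repr z).2)))%:C.

Lemma cosDpi2z (x : R) (k : int) : cos (x + 2 * pi * k%:~R) = cos x.
Proof.
have H (y : R) (n : nat) : cos (y + 2 * pi * n%:R) = cos y.
  by rewrite -(periodicn (@cosD2pi R) n y); congr cos; rewrite -mulr_natr mulr2n; ring.
case: k => n; first exact: H.
by rewrite NegzE mulrNz -[LHS](H _ n.+1); congr cos; ring.
Qed.

Lemma cosfun_pi (a : int * int) (u : R * R) :
  cosfun a (\pi_charvar u) = (2 * cos (2 * pi * (a.1%:~R * u.1 + a.2%:~R * u.2)))%:C.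
Proof.
rewrite /cosfun; congr ((2 * _)%:C).
have /asboolP[m [n H]] : charvar_rel u (repr (\pi_charvar u)).
  by rewrite -[charvar_rel _ _]/(charvar_equiv _ _) -eqmodE reprK.
have K : a.1%:~R * m%:~R + a.2%:~R * n%:~R = (a.1 * m + a.2 * n)%:~R :> R.
  by rewrite intrD !intrM.
case: H => -> /=.
  by rewrite -[RHS](cosDpi2z _ (a.1 * m + a.2 * n)) -K; congr cos; ring.
by rewrite -[RHS]cosN -[RHS](cosDpi2z _ (a.1 * m + a.2 * n)) -K; congr cos; ring.
Qed.

End CharacterVariety.

Definition is_obs (R : realType) : {pred charvar R -> R[i]} := fun f =>
  `[< exists s : seq (R[i] * (int * int)), f = \sum_(i <- s) i.1 *: cosfun i.2 >].

(* The vector space of observables.  The parameter r plays no role in the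
   underlying space, it selects the product. *)
Record obs (R : realType) (r : nat) :=
  Obs { obs_val :> charvar R -> R[i] ; _ : obs_val \in @is_obs R }.

Section Observables.
Variables (R : realType) (r : nat).
Local Notation C := R[i].
Local Notation X := (charvar R).
Local Notation t := (tpar R r).
Implicit Types (a b c : int * int) (s : seq (C * (int * int))).
Local Notation is_obs := (@is_obs R).
Local Notation obs := (obs R r).
Local Notation obs_val := (@obs_val R r).

Lemma is_obs_submod : submod_closed is_obs.
Proof.
split; first by apply/asboolP; exists [::]; rewrite big_nil.
move=> k _ _ /asboolP[s ->] /asboolP[s' ->]; apply/asboolP.
exists ([seq (k * i.1, i.2) | i <- s] ++ s'); rewrite big_cat big_map /= scaler_sumr.
by congr (_ + _); apply: eq_bigr => i _; rewrite scalerA.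
Qed.

HB.instance Definition _ := GRing.isSubmodClosed.Build C (X -> C) is_obs
  (GRing.submod_closed_semi is_obs_submod).
HB.instance Definition _ := [isSub for obs_val].
HB.instance Definition _ := [Choice of obs by <:].
HB.instance Definition _ := [SubChoice_isSubLmodule of obs by <:].

Lemma cosfun_is_obs a : cosfun a \in is_obs.
Proof. by apply/asboolP; exists [:: (1, a)]; rewrite big_seq1 scale1r. Qed.

Definition obsC_pair a : obs := Obs r (cosfun_is_obs a).

Definition sympl a b : int := a.1 * b.2 - a.2 * b.1.

Definition starC a b : obs :=
  t ^ sympl a b *: obsC_pair (a + b) + t ^ (- sympl a b) *: obsC_pair (a - b).

Definition lincomb s : obs := \sum_(i <- s) i.1 *: obsC_pair i.2.

Lemma obs_val_sum (I : Type) (s : seq I) (k : I -> C) (F : I -> obs) :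
  obs_val (\sum_(i <- s) k i *: F i) = \sum_(i <- s) k i *: obs_val (F i).
Proof.
rewrite -[LHS]/(val _) (raddf_sum (val : obs -> X -> C)).
by apply: eq_bigr => i _; exact: GRing.valZ.
Qed.

Lemma lincomb_ex (f : obs) : exists s, f = lincomb s.
Proof.
case: f => f fP; have /asboolP[s fE] := fP; exists s; apply: val_inj => /=.
by rewrite fE obs_val_sum.
Qed.

Definition coords (f : obs) : seq (C * (int * int)) := projT1 (cid (lincomb_ex f)).

Lemma coordsK (f : obs) : lincomb (coords f) = f.
Proof. by rewrite /coords; case: cid. Qed.

(* The bilinear extension of starC, computed on arbitrary expansions; it does
   not depend on them by starE below. *)
Definition star (f g : obs) : obs :=
  \sum_(i <- coords f) \sum_(j <- coords g) (i.1 * j.1) *: starC i.2 j.2.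


Let ph a (u : R * R) : R := 2 * pi * (a.1%:~R * u.1 + a.2%:~R * u.2).

Let sh (e : R) b : R * R :=
  (e * b.2%:~R / (4 * r%:R), - (e * b.1%:~R / (4 * r%:R))).

(* Since t ^ sympl a b = expi (ph a (sh 1 b)), the product of f with C(b) only
   involves translates of f, whence the independence of the expansion of f. *)
Let act (e : R) b (f : X -> C) : X -> C := fun z =>
  expi (ph b (repr z)) * f (\pi_(charvar R) (repr z + sh e b)) +
  expi (- ph b (repr z)) * f (\pi_(charvar R) (repr z - sh e b)).

Let scale_val (k : C) (f : X -> C) z : (k *: f) z = k * f z.
Proof. by []. Qed.

Let act_sum e b (I : Type) (s : seq I) (k : I -> C) (F : I -> X -> C) :
  act e b (\sum_(i <- s) k i *: F i) = \sum_(i <- s) k i *: act e b (F i).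
Proof.
apply/funext => z; rewrite /act !fct_sumE !mulr_sumr -big_split /=.
by apply: eq_bigr => i _; rewrite !scale_val /act; ring.
Qed.

Let cosfunE a (u : R * R) : cosfun a (\pi_(charvar R) u) = expi (ph a u) + expi (- ph a u).
Proof. by rewrite cosfun_pi cos_expi. Qed.

Let phD a u v : ph a (u + v) = ph a u + ph a v.
Proof. by rewrite /ph /=; ring. Qed.

Let phN a u : ph a (- u) = - ph a u.
Proof. by rewrite /ph /=; ring. Qed.

Let phDl a b u : ph (a + b) u = ph a u + ph b u.
Proof. by rewrite /ph /= !intrD; ring. Qed.

Let phNl a u : ph (- a) u = - ph a u.
Proof. by rewrite /ph /= !mulrNz; ring. Qed.

Let tE a b : t ^ sympl a b = expi (ph a (sh 1 b)).
Proof.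
rewrite /tpar expi_int; congr expi; rewrite /ph /sh /sympl /= intrB !intrM.
have [->|r0] := eqVneq r 0; first by rewrite !mulr0 invr0 !mulr0 oppr0 !mulr0 addr0 mulr0.
have {}r0 : r%:R != 0 :> R by rewrite pnatr_eq0.
by field.
Qed.

Let sympl_antisym a b : sympl b a = - sympl a b.
Proof. by rewrite /sympl; ring. Qed.

Let shN b : sh (-1) b = - sh 1 b.
Proof. by rewrite /sh; congr pair => /=; ring. Qed.

Lemma starC_val a b (z : X) :
  starC a b z = t ^ sympl a b * cosfun (a + b) z + t ^ (- sympl a b) * cosfun (a - b) z.
Proof. by []. Qed.

Let starC_r a b : starC a b = act 1 b (cosfun a) :> (X -> C).
Proof.
apply/funext => z; rewrite starC_val /act -[z in LHS]reprK !cosfunE.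
rewrite -!invr_expz tE -expiN.
rewrite !(phD, phN, phDl, phNl) !(opprD, opprK) !expiD; ring.
Qed.

Let starC_l a b : starC a b = act (-1) a (cosfun b) :> (X -> C).
Proof.
apply/funext => z; rewrite starC_val /act -[z in LHS]reprK !cosfunE.
rewrite -[sympl a b]opprK -sympl_antisym opprK.
rewrite -!invr_expz tE -expiN shN.
rewrite !(phD, phN, phDl, phNl) !(opprD, opprK) !expiD; ring.
Qed.

Lemma obs_inj : injective obs_val.
Proof. exact: val_inj. Qed.

Let lincomb_val s : lincomb s = \sum_(i <- s) i.1 *: cosfun i.2 :> (X -> C).
Proof. by rewrite obs_val_sum. Qed.

Lemma starE s s' :
  star (lincomb s) (lincomb s') =
  \sum_(i <- s) \sum_(j <- s') (i.1 * j.1) *: starC i.2 j.2.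
Proof.
have L b s1 s2 : lincomb s1 = lincomb s2 ->
    \sum_(i <- s1) i.1 *: starC i.2 b = \sum_(i <- s2) i.1 *: starC i.2 b.
  move=> E; apply: obs_inj; rewrite !obs_val_sum.
  under eq_bigr do rewrite starC_r.
  under [RHS]eq_bigr do rewrite starC_r.
  by rewrite -!act_sum -!lincomb_val E.
have L' a s1 s2 : lincomb s1 = lincomb s2 ->
    \sum_(i <- s1) i.1 *: starC a i.2 = \sum_(i <- s2) i.1 *: starC a i.2.
  move=> E; apply: obs_inj; rewrite !obs_val_sum.
  under eq_bigr do rewrite starC_l.
  under [RHS]eq_bigr do rewrite starC_l.
  by rewrite -!act_sum -!lincomb_val E.
rewrite /star; under eq_bigr => i _.
  under eq_bigr do rewrite -scalerA.
  rewrite -scaler_sumr (L' _ _ s') ?coordsK // scaler_sumr.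
  under eq_bigr do rewrite scalerA.
  over.
rewrite exchange_big [RHS]exchange_big; apply: eq_bigr => j _ /=.
under eq_bigr do rewrite mulrC -scalerA.
under [RHS]eq_bigr do rewrite mulrC -scalerA.
by rewrite -!scaler_sumr (L _ _ s) ?coordsK.
Qed.

Let lincomb1 a : lincomb [:: (1, a)] = obsC_pair a.
Proof. by rewrite /lincomb big_seq1 scale1r. Qed.

Let lincombD k s s' :
  lincomb ([seq (k * i.1, i.2) | i <- s] ++ s') = k *: lincomb s + lincomb s'.
Proof.
rewrite /lincomb big_cat big_map /= scaler_sumr.
by congr (_ + _); apply: eq_bigr => i _; rewrite scalerA.
Qed.

Lemma star_obsC a b : star (obsC_pair a) (obsC_pair b) = starC a b.
Proof. by rewrite -!lincomb1 starE !big_seq1 mulr1 scale1r. Qed.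

Lemma star_linearl (k : C) (f f' g : obs) : star (k *: f + f') g = k *: star f g + star f' g.
Proof.
have [[[s ->] [s' ->]] [s2 ->]] := (lincomb_ex f, lincomb_ex f', lincomb_ex g).
rewrite -lincombD !starE big_cat big_map /= scaler_sumr; congr (_ + _).
apply: eq_bigr => i _; rewrite scaler_sumr; apply: eq_bigr => j _.
by rewrite scalerA mulrA.
Qed.

Lemma star_linearr (k : C) (f g g' : obs) : star f (k *: g + g') = k *: star f g + star f g'.
Proof.
have [[[s ->] [s' ->]] [s2 ->]] := (lincomb_ex g, lincomb_ex g', lincomb_ex f).
rewrite -lincombD !starE scaler_sumr -big_split; apply: eq_bigr => i _ /=.
rewrite big_cat big_map /= scaler_sumr; congr (_ + _).
by apply: eq_bigr => j _; rewrite scalerA mulrCA.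
Qed.

Lemma starDl (f f' g : obs) : star (f + f') g = star f g + star f' g.
Proof. by rewrite -[f in LHS]scale1r star_linearl scale1r. Qed.

Lemma starDr (f g g' : obs) : star f (g + g') = star f g + star f g'.
Proof. by rewrite -[g in LHS]scale1r star_linearr scale1r. Qed.

Let star0l (g : obs) : star 0 g = 0.
Proof. by apply: (addrI (star 0 g)); rewrite -starDl !addr0. Qed.

Let star0r (g : obs) : star g 0 = 0.
Proof. by apply: (addrI (star g 0)); rewrite -starDr !addr0. Qed.

Lemma starZl (k : C) (f g : obs) : star (k *: f) g = k *: star f g.
Proof. by rewrite -[k *: f]addr0 star_linearl star0l addr0. Qed.

Lemma starZr (k : C) (f g : obs) : star f (k *: g) = k *: star f g.
Proof. by rewrite -[k *: g]addr0 star_linearr star0r addr0. Qed.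

Lemma obs_ind (P : obs -> Prop) :
  P 0 -> (forall k a (f : obs), P f -> P (k *: obsC_pair a + f)) -> forall f, P f.
Proof.
move=> P0 PD f; have [s ->] := lincomb_ex f.
elim: s => [|i s IHs]; first by rewrite /lincomb big_nil.
by rewrite /lincomb big_cons; apply: PD.
Qed.

Lemma starA : associative (@star).
Proof.
move=> f g h; elim/obs_ind: f => [|k a f IHf]; first by rewrite !star0l.
rewrite !star_linearl IHf; congr (_ *: _ + _).
elim/obs_ind: g {IHf} => [|k' b g IHg]; first by rewrite !(star0l, star0r).
rewrite star_linearl !star_linearr star_linearl IHg; congr (_ *: _ + _).
elim/obs_ind: h {IHg} => [|k2 c h IHh]; first by rewrite !star0r.
rewrite !star_linearr IHh; congr (_ *: _ + _).
rewrite !star_obsC /starC starDl starDr !starZl !starZr !star_obsC /starC.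
rewrite !scalerDr !scalerA -!expfzDr ?tpar_neq0 //.
rewrite [X in _ = _ + X]addrC [RHS]addrACA.
rewrite /sympl /=; congr (_ + _ + (_ + _)); congr (_ ^ _ *: obsC_pair _);
  rewrite ?opprD ?opprK ?addrA //; ring.
Qed.

(* C(0,0) is twice the unit. *)
Definition obs1 : obs := 2^-1 *: obsC_pair 0.

Lemma cosfunN a : cosfun (- a) = cosfun a :> (X -> C).
Proof. by apply/funext => z; rewrite -[z]reprK !cosfunE phNl opprK addrC. Qed.

Lemma obsC_pairN a : obsC_pair (- a) = obsC_pair a.
Proof. by apply: obs_inj; rewrite /= cosfunN. Qed.

Let half (f : obs) : (2^-1 : C) *: (f + f) = f.
Proof.
by rewrite -[f in LHS]scale1r -scalerDl scalerA mulVf ?scale1r // pnatr_eq0.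
Qed.

Let star1l : left_id obs1 (@star).
Proof.
move=> f; elim/obs_ind: f => [|k a f IHf]; first by rewrite star0r.
rewrite star_linearr IHf; congr (_ *: _ + _).
rewrite starZl star_obsC /starC /sympl /= !mul0r subr0 oppr0 expr0z.
by rewrite !scale1r add0r sub0r obsC_pairN half.
Qed.

Let star1r : right_id obs1 (@star).
Proof.
move=> f; elim/obs_ind: f => [|k a f IHf]; first by rewrite star0l.
rewrite star_linearl IHf; congr (_ *: _ + _).
rewrite starZr star_obsC /starC /sympl /= !mulr0 subr0 oppr0 expr0z.
by rewrite !scale1r (addr0 a : a + 0 = a) half.
Qed.

Let obs1_neq0 : obs1 != 0.
Proof.
apply/negP => /eqP/(congr1 (fun f : obs => f (\pi_(charvar R) 0))) /=.
rewrite -[LHS]/(2^-1 * cosfun 0 _) cosfunE /ph /= !mulr0 addr0 mulr0 oppr0 expi0.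
by move/eqP; rewrite -mulr2n mulVf ?pnatr_eq0 // oner_eq0.
Qed.

HB.instance Definition _ := GRing.Zmodule_isNzRing.Build obs
  starA star1l star1r starDl starDr obs1_neq0.
HB.instance Definition _ := GRing.Lmodule_isLalgebra.Build C obs
  (fun k f g => esym (starZl k f g)).
HB.instance Definition _ := GRing.Lalgebra_isAlgebra.Build C obs
  (fun k f g => esym (starZr k f g)).

Definition obsC (p q : int) : obs := obsC_pair (p, q).

Lemma obsCE (p q : int) (x y : R) :
  obsC p q (\pi_(charvar R) (x, y)) = (2 * cos (2 * pi * (p%:~R * x + q%:~R * y)))%:C.
Proof. exact: cosfun_pi. Qed.

Lemma obsC_mul (m n p q : int) :
  obsC m n * obsC p q =
  t ^ (m * q - n * p) *: obsC (m + p) (n + q) +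
  t ^ (- (m * q - n * p)) *: obsC (m - p) (n - q).
Proof. exact: star_obsC. Qed.

Lemma obsC00 : obsC 0 0 = 2 :> obs.
Proof.
have H : obsC 0 0 = 2 *: (1 : obs) by rewrite scalerA mulfV ?pnatr_eq0 // scale1r.
by rewrite H scaler_nat.
Qed.

Lemma obsCN (p q : int) : obsC (- p) (- q) = obsC p q.
Proof. exact: obsC_pairN (p, q). Qed.

End Observables.

(* Unital C*-algebras over R[i], with norm cnorm and involution adjoint.  The
   norm is a field of the structure because algType and completeNormedModType
   have no common extension compatible with the join of ring and norm already
   declared at numDomainType. *)
HB.mixin Record isCStarAlgebra (R : realType) A of GRing.Algebra R[i] A := {
  cnorm : A -> R ;
  adjoint : A -> A ;
  cnorm_eq0 : forall x, cnorm x = 0 -> x = 0 ;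
  cnormD : forall x y, cnorm (x + y) <= cnorm x + cnorm y ;
  cnormZ : forall (k : R[i]) x, (cnorm (k *: x))%:C = `|k| * (cnorm x)%:C ;
  cnormM : forall x y, cnorm (x * y) <= cnorm x * cnorm y ;
  cnorm_complete : forall u : nat -> A,
    (forall e, 0 < e ->
       exists N, forall m n, (N <= m)%N -> (N <= n)%N -> cnorm (u m - u n) < e) ->
    exists l, forall e, 0 < e ->
       exists N, forall n, (N <= n)%N -> cnorm (u n - l) < e ;
  adjointK : involutive adjoint ;
  adjointD : forall x y, adjoint (x + y) = adjoint x + adjoint y ;
  adjointZ : forall (k : R[i]) x, adjoint (k *: x) = k^* *: adjoint x ;
  adjointM : forall x y, adjoint (x * y) = adjoint y * adjoint x ;
  cstar_identity : forall x, cnorm (adjoint x * x) = cnorm x ^+ 2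
}.

#[short(type="cstarAlgType")]
HB.structure Definition CStarAlgebra (R : realType) :=
  { A of isCStarAlgebra R A & GRing.Algebra R[i] A }.

Section NoncommutativeTorus.
Variable R : realType.
Implicit Types A B : cstarAlgType R.

Definition is_unitary A (x : A) : Prop := adjoint x * x = 1 /\ x * adjoint x = 1.

(* Integer powers of a unitary, whose inverse is its adjoint. *)
Definition upow A (x : A) (n : int) : A :=
  match n with Posz k => x ^+ k | Negz k => adjoint x ^+ k.+1 end.

Definition is_star_morphism A B (phi : A -> B) : Prop :=
  forall x, phi (adjoint x) = adjoint (phi x).

Definition q_commuting_unitaries (q : R[i]) A (U V : A) : Prop :=
  [/\ is_unitary U, is_unitary V & U * V = q *: (V * U)].

(* (A, U, V) is the universal unital C*-algebra generated by two unitaries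
   satisfying UV = q VU. *)
Definition is_nc_torus (q : R[i]) A (U V : A) : Prop :=
  q_commuting_unitaries q U V /\
  forall B (u v : B), q_commuting_unitaries q u v ->
    exists phi : {lrmorphism A -> B},
      [/\ is_star_morphism phi, phi U = u, phi V = v &
          forall psi : {lrmorphism A -> B},
            is_star_morphism psi -> psi U = u -> psi V = v -> psi =1 phi].

End NoncommutativeTorus.

(* Main.v *)
Require Import Defs.
From HB Require Import structures.
From mathcomp Require Import all_boot all_order all_algebra.
From mathcomp Require Import complex ring.
From mathcomp Require Import all_classical all_reals all_analysis.

Import Order.TTheory GRing.Theory Num.Theory.

Local Open Scope ring_scope.
Local Open Scope complex_scope.

(* A family of joint eigenvectors with pairwise distinct eigencharacters
   u |-> exp(i a.u) is linearly free.  This applies to the exponentials on the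
   plane under translations, and to the Weyl-ordered monomials
   w_a = t^{-pq} U^p V^q, a = (p, q), under the gauge automorphisms that the
   universal property provides; no concrete representation of the torus is
   needed.  Hence C(a) = e_a + e_{-a} and w_a + w_{-a} satisfy the same linear
   relations, which makes C(a) |-> w_a + w_{-a} well defined and injective, and
   multiplicativity follows from w_a w_b = t^{a ^ b} w_{a+b}. *)

(** * Weight vectors and their linear independence *)

Definition pairing {R : realType} (a : int * int) (u : R * R) : R :=
  a.1%:~R * u.1 + a.2%:~R * u.2.

Section Weights.
Context {R : realType}.

Lemma pairing0r (a : int * int) : pairing a (0 : R * R) = 0.
Proof. by rewrite /pairing /= !mulr0 addr0. Qed.

Lemma pairingNl (a : int * int) (u : R * R) : pairing (- a) u = - pairing a u.
Proof. by rewrite /pairing /= !mulrNz; ring. Qed.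

Lemma pairingDr (a : int * int) (u v : R * R) :
  pairing a (u + v) = pairing a u + pairing a v.
Proof. by rewrite /pairing /=; ring. Qed.

Lemma expi_pi : expi (pi : R) = -1.
Proof. by apply/eqP; rewrite /expi cospi sinpi eq_complex /= oppr0 !eqxx. Qed.

(** The vector [u] lives on a coordinate where [a] and [b] differ and is scaled so that the two
    phases differ by [pi]; equal exponentials would then give [-1 = 1]. *)
Lemma pairing_separates (a b : int * int) : a != b ->
  exists u : R * R, expi (pairing a u) != expi (pairing b u).
Proof.
have N11 : -1 != 1 :> R[i] by rewrite -subr_eq0 -opprD oppr_eq0 (pnatr_eq0 _ 2).
have E (m n : int) : m != n ->
    expi (m%:~R * (pi / (m - n)%:~R)) != expi (n%:~R * (pi / (m - n)%:~R) : R).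
  rewrite -subr_eq0 -(intr_eq0 R) => mn0; apply: contra_neq N11 => e.
  have := expiD (m%:~R * (pi / (m - n)%:~R)) (- (n%:~R * (pi / (m - n)%:~R)) : R).
  rewrite e -expiD subrr expi0 -mulrBl -intrB mulrC divfK //.
  by rewrite expi_pi.
case: a b => [a1 a2] [b1 b2]; rewrite xpair_eqE negb_and => /orP[/E h|/E h].
  by exists (pi / (a1 - b1)%:~R, 0); rewrite /pairing /= !mulr0 !addr0.
by exists (0, pi / (a2 - b2)%:~R); rewrite /pairing /= !mulr0 !add0r.
Qed.

(** The operators need not form a group action: the freeness argument uses one [u] at a time, chosen
    to separate two given weights. *)
Definition weight_family {V : lmodType R[i]} (w : int * int -> V) : Prop :=
  (forall a, w a != 0) /\
  forall u : R * R, exists T : {linear V -> V},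
    forall a, T (w a) = expi (pairing a u) *: w a.

(** Induction on [s]: applying [T] minus the eigenvalue of the head [a] kills the head term and
    multiplies the coefficient of [b] by a difference of eigenvalues, which is nonzero when [u]
    separates [a] and [b]. The head coefficient then vanishes because [w a] is nonzero. *)
Lemma weight_family_free {V : lmodType R[i]} {w : int * int -> V} :
  weight_family w -> forall (s : seq (int * int)) (c : int * int -> R[i]),
  uniq s -> \sum_(a <- s) c a *: w a = 0 -> forall a, a \in s -> c a = 0.
Proof.
move=> [w0 wT]; elim=> [//|a s IHs] c /= /andP[as_ us]; rewrite big_cons => s0.
have cs b : b \in s -> c b = 0.
  move=> bs; have ba : b != a by apply: contraNneq as_ => <-.
  have [u chi] := pairing_separates _ _ ba; have [T Tw] := wT u.
  have : \sum_(x <- s) (c x * (expi (pairing x u) - expi (pairing a u))) *: w x = 0.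
    have SE : \sum_(x <- s) c x *: w x = - (c a *: w a).
      by apply/eqP; rewrite -addr_eq0 addrC s0.
    transitivity (T (\sum_(x <- s) c x *: w x)
                  - expi (pairing a u) *: \sum_(x <- s) c x *: w x).
      rewrite linear_sum scaler_sumr -sumrB; apply: eq_bigr => x _.
      by rewrite linearZ /= Tw !scalerA -scalerBl mulrBr [c x * expi (pairing a u)]mulrC.
    by rewrite SE linearN linearZ /= Tw scalerN !scalerA mulrC subrr.
  move=> /(IHs _ us)/(_ _ bs)/eqP; rewrite mulf_eq0 subr_eq0 (negPf chi) orbF.
  by move/eqP.
move: s0; rewrite big_seq big1 ?addr0 => [|i /cs ->]; last by rewrite scale0r.
move/eqP; rewrite scaler_eq0 (negPf (w0 a)) orbF => /eqP ca b.
by rewrite inE => /predU1P[->|/cs].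
Qed.

(** An expansion may repeat an index; collecting equal indices yields the duplicate-free sum that
    [weight_family_free] requires. *)
Lemma big_coef {V : lmodType R[i]} (F : int * int -> V)
    (s : seq (R[i] * (int * int))) :
  \sum_(i <- s) i.1 *: F i.2 =
  \sum_(a <- undup [seq i.2 | i <- s]) (\sum_(i <- s | i.2 == a) i.1) *: F a.
Proof.
under [RHS]eq_bigr do rewrite scaler_suml big_mkcond.
rewrite exchange_big big_seq [RHS]big_seq; apply: eq_bigr => i si.
rewrite -big_mkcond; under eq_bigl do rewrite eq_sym.
rewrite -big_filter (filter_pred1_uniq _ _) ?big_seq1 ?undup_uniq // mem_undup.
exact: map_f.
Qed.

(** All collected coefficients vanish by freeness, so the relation passes to an arbitrary family
    [F], free or not. *)
Lemma weight_relation {V W : lmodType R[i]} {w : int * int -> V}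
    (F : int * int -> W) (s : seq (R[i] * (int * int))) :
  weight_family w ->
  \sum_(i <- s) i.1 *: w i.2 = 0 -> \sum_(i <- s) i.1 *: F i.2 = 0.
Proof.
move=> wf; rewrite !big_coef => /(weight_family_free wf _ _ (undup_uniq _)) c0.
by rewrite big_seq big1 // => a /c0 ->; rewrite scale0r.
Qed.

Lemma weight_even_relation {V W : lmodType R[i]} {w : int * int -> V}
    (F : int * int -> W) (s : seq (R[i] * (int * int))) :
  weight_family w ->
  \sum_(i <- s) i.1 *: (w i.2 + w (- i.2)) = 0 ->
  \sum_(i <- s) i.1 *: (F i.2 + F (- i.2)) = 0.
Proof.
move=> wf.
(* An even sum is an ordinary sum over [s] followed by its mirror image. *)
have E (X : lmodType R[i]) (G : int * int -> X) :
    \sum_(i <- s) i.1 *: (G i.2 + G (- i.2)) =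
    \sum_(i <- s ++ [seq (i.1, - i.2) | i <- s]) i.1 *: G i.2.
  under eq_bigr do rewrite scalerDr.
  by rewrite big_split big_cat big_map.
by rewrite !E; exact: weight_relation.
Qed.

(** * Observables as even exponentials on the plane *)

Definition plane_character (a : int * int) : R * R -> R[i] :=
  fun u => expi (pairing a u).

Definition translation (v : R * R) (f : R * R -> R[i]) : R * R -> R[i] :=
  fun u => f (u + v).

Lemma translation_linear (v : R * R) : linear (translation v).
Proof. by move=> k f g; apply/funext => u. Qed.

Lemma plane_character_weight : weight_family plane_character.
Proof.
split=> [a|v].
  apply/eqP => /(congr1 (fun f => f 0)); rewrite /plane_character pairing0r expi0.
  by move/eqP; rewrite (_ : (0 : R * R -> R[i]) 0 = 0) // oner_eq0.
pose T := GRing.isLinear.Build _ _ _ _ _ (translation_linear v).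
pose L : {linear (R * R -> R[i]) -> (R * R -> R[i])} := HB.pack (translation v) T.
exists L => a; apply/funext => u.
by rewrite /L /= /translation /plane_character pairingDr expiD mulrC.
Qed.

Lemma lincomb_eq0 (r : nat) (s : seq (R[i] * (int * int))) :
  lincomb r s = 0 ->
  \sum_(i <- s) i.1 *: (plane_character i.2 + plane_character (- i.2)) = 0.
Proof.
move=> s0; apply/funext => u; rewrite fct_sumE.
(* The rescaling absorbs the factor [2 * pi] that [cosfun] has and [pairing] lacks. *)
set u' : R * R := (u.1 / (2 * pi), u.2 / (2 * pi)).
have pi0 : pi != 0 :> R by rewrite gt_eqF // pi_gt0.
transitivity (lincomb r s (\pi_(charvar R)%qT u')); last by rewrite s0.
rewrite obs_val_sum fct_sumE; apply: eq_bigr => i _.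
rewrite -[LHS]/(_ * (_ + _)) -[RHS]/(_ * cosfun _ _); congr (_ * _).
rewrite cosfun_pi cos_expi /plane_character pairingNl.
have -> // : 2 * pi * ((i.2).1%:~R * u'.1 + (i.2).2%:~R * u'.2) = pairing i.2 u.
by rewrite /u' /pairing /=; move: (pi : R) pi0 => c c0; field.
Qed.

End Weights.

(** * Integer powers of q-commuting unitaries *)

Section Unitaries.
Context {R : realType} {A : cstarAlgType R}.
Implicit Types (x y u v : A) (c k : R[i]) (n p : int).

Lemma adjoint_unitary {x} : Defs.is_unitary x -> Defs.is_unitary (adjoint x).
Proof. by rewrite /Defs.is_unitary adjointK => -[]. Qed.

Lemma upowN x n : upow (adjoint x) n = upow x (- n).
Proof. by case: n => [[|n]|n] //=; rewrite adjointK. Qed.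

Lemma upowS {x} n : Defs.is_unitary x -> upow x (1 + n) = x * upow x n.
Proof.
move=> [x1 x2]; case: n => [n|[|n]]; first by rewrite -PoszD add1n /= exprS.
  by rewrite /= expr1 x2.
rewrite (_ : 1 + Negz n.+1 = Negz n); last by rewrite !NegzE -[n.+2]add1n PoszD opprD addrA subrr add0r.
by rewrite /= [in RHS]exprS mulrA x2 mul1r.
Qed.

(** This is [upowS] for the unitary [adjoint x], whose powers are those of [x] with opposite
    exponents. *)
Lemma upowB1 {x} n : Defs.is_unitary x -> upow x (- 1 + n) = adjoint x * upow x n.
Proof.
move=> ux; rewrite -[X in upow x X]opprK opprD opprK -upowN.
by rewrite (upowS _ (adjoint_unitary ux)) upowN opprK.
Qed.

Lemma upowD {x} n p : Defs.is_unitary x -> upow x (n + p) = upow x n * upow x p.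
Proof.
move=> ux; elim/int_rect: n => [|n IHn|n IHn]; first by rewrite add0r mul1r.
  by rewrite -add1n PoszD -addrA !upowS // IHn mulrA.
by rewrite -add1n PoszD opprD -addrA !upowB1 // IHn mulrA.
Qed.

Lemma upow_qcomm {x y} c n : c != 0 -> Defs.is_unitary x ->
  x * y = c *: (y * x) -> upow x n * y = c ^ n *: (y * upow x n).
Proof.
move=> c0 ux xy; have [xl xr] := ux.
(* Multiplying [xy] by [adjoint x] on both sides settles exponent -1, which drives the induction on
   negative [n]. *)
have x'y : adjoint x * y = c^-1 *: (y * adjoint x).
  have -> : y * adjoint x = adjoint x * (x * y) * adjoint x.
    by rewrite mulrA xl mul1r.
  by rewrite xy -scalerAr -scalerAl scalerA mulVf // scale1r -!mulrA xr mulr1.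
elim/int_rect: n => [|n IHn|n IHn]; first by rewrite expr0z scale1r mul1r mulr1.
  rewrite -add1n PoszD upowS // -mulrA IHn -scalerAr [x * (y * _)]mulrA xy -scalerAl scalerA.
  by rewrite -mulrA expfzDr // expr1z mulrC.
rewrite -add1n PoszD opprD upowB1 // -mulrA IHn -scalerAr [adjoint x * (y * _)]mulrA x'y -scalerAl.
by rewrite scalerA -mulrA expfzDr // -exprN1 mulrC.
Qed.

(** Two uses of [upow_qcomm]: powers of [u] first pass [v], then powers of [v] pass [upow u p] with
    constant [c ^ (- p)]. *)
Lemma upow_qcomm2 {u v} c n p : c != 0 -> Defs.is_unitary u -> Defs.is_unitary v ->
  u * v = c *: (v * u) ->
  upow v n * upow u p = c ^ (- (n * p)) *: (upow u p * upow v n).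
Proof.
move=> c0 uu uv e.
have /(upow_qcomm _ n (expfz_neq0 (- p) c0) uv) -> :
    v * upow u p = c ^ (- p) *: (upow u p * v).
  rewrite (upow_qcomm _ p c0 uu e) scalerA -expfzDr // addNr expr0z scale1r //.
by rewrite exprz_exp mulNr mulrC.
Qed.

(** For negative [n] the power is one of the adjoint, and unimodularity turns the conjugate of [k]
    into its inverse. *)
Lemma upow_scale k x n : k * Num.conj k = 1 ->
  upow (k *: x) n = k ^ n *: upow x n.
Proof.
move=> kk; have k0 : k != 0.
  by apply: contra_eq_neq kk => ->; rewrite mul0r eq_sym oner_eq0.
have kE : Num.conj k = k^-1 by apply: (mulfI k0); rewrite kk mulfV.
case: n => n /=; first by rewrite exprZn exprnP.
by rewrite adjointZ kE exprZn NegzE -exprnN exprVn.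
Qed.

Lemma unitary_scale {x} k : k * Num.conj k = 1 -> Defs.is_unitary x -> Defs.is_unitary (k *: x).
Proof.
move=> kk [x1 x2]; rewrite /Defs.is_unitary adjointZ -!scalerAl -!scalerAr !scalerA.
by rewrite [Num.conj k * k]mulrC kk x1 x2 scale1r.
Qed.

Lemma lrmorph_upow {B : cstarAlgType R} (phi : {lrmorphism A -> B}) x n :
  is_star_morphism phi -> phi (upow x n) = upow (phi x) n.
Proof. by move=> ph; case: n => n; rewrite /= rmorphXn /= ?ph. Qed.

Lemma expi_conj (x : R) : expi x * Num.conj (expi x) = 1.
Proof.
rewrite mulrC; apply/eqP; rewrite eq_complex /expi /= !mulNr opprK -!expr2.
by rewrite cos2Dsin2 eqxx mulrC subrr eqxx.
Qed.

End Unitaries.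

(** * Weyl-ordered monomials *)

Section Weyl.
Context {R : realType} {A : cstarAlgType R} (t : R[i]) (U V : A).

Definition weyl (a : int * int) : A :=
  t ^ (- (a.1 * a.2)) *: (upow U a.1 * upow V a.2).

Hypotheses (t0 : t != 0) (hUV : q_commuting_unitaries (t ^+ 2) U V).

Lemma weyl0 : weyl 0 = 1.
Proof. by rewrite /weyl /= mul0r oppr0 expr0z scale1r mulr1. Qed.

(** Moving [upow V a.2] past [upow U b.1] costs [t ^ (- 2 a.2 b.1)]. Together with the two
    normalizing factors, this leaves the antisymmetric exponent [sympl a b] beside the normalization
    of [a + b]. *)
Lemma weylM a b : weyl a * weyl b = t ^ sympl a b *: weyl (a + b).
Proof.
have [uU uV UV] := hUV.
rewrite /weyl -scalerAl -scalerAr !scalerA.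
rewrite -mulrA [upow V _ * _]mulrA.
rewrite (upow_qcomm2 _ _ _ (expf_neq0 2 t0) uU uV UV).
rewrite -scalerAl -scalerAr scalerA !upowD // !mulrA; congr (_ *: _).
rewrite exprnP exprz_exp -!expfzDr //; congr (_ ^ _).
by rewrite /sympl /=; ring.
Qed.

Lemma weyl_neq0 a : weyl a != 0.
Proof.
have : weyl a * weyl (- a) = 1.
  rewrite weylM subrr weyl0 (_ : sympl a (- a) = 0) ?scale1r //.
  by rewrite /sympl /=; ring.
by apply: contra_eq_neq => ->; rewrite mul0r eq_sym oner_eq0.
Qed.

Lemma weyl_evenM a b :
  (weyl a + weyl (- a)) * (weyl b + weyl (- b)) =
  t ^ sympl a b *: (weyl (a + b) + weyl (- (a + b))) +
  t ^ (- sympl a b) *: (weyl (a - b) + weyl (- (a - b))).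
Proof.
rewrite mulrDl !mulrDr !weylM.
have -> : sympl a (- b) = - sympl a b by rewrite /sympl /=; ring.
have -> : sympl (- a) b = - sympl a b by rewrite /sympl /=; ring.
have -> : sympl (- a) (- b) = sympl a b by rewrite /sympl /=; ring.
rewrite !scalerDr -opprD [- (a - b)]opprB [- a + b]addrC.
by rewrite [_ *: weyl (b - a) + _]addrC addrACA.
Qed.

End Weyl.

(* The operators are the automorphisms U |-> e^{ix} U, V |-> e^{iy} V. *)
Lemma weyl_weight {R : realType} {A : cstarAlgType R} {t : R[i]} {U V : A} :
  t != 0 -> is_nc_torus (t ^+ 2) U V -> weight_family (weyl t U V).
Proof.
move=> t0 [hUV univ]; split; first exact: weyl_neq0.
move=> u; have [uU uV UV] := hUV.
have ex := expi_conj u.1; have ey := expi_conj u.2.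
(* Unimodular phases preserve unitarity and the commutation relation, so universality applies with
   [A] itself as target. *)
have /univ[phi [phs phU phV _]] :
    q_commuting_unitaries (t ^+ 2) (expi u.1 *: U) (expi u.2 *: V).
  split; try exact: unitary_scale.
  rewrite -!scalerAl -!scalerAr UV !scalerA; congr (_ *: _); ring.
exists phi => a; rewrite /weyl linearZ /= rmorphM /= !lrmorph_upow // phU phV.
rewrite !upow_scale // -scalerAl -scalerAr !scalerA; congr (_ *: _).
by rewrite !expi_int -mulrA -expiD mulrC.
Qed.

(** * The embedding of the algebra of observables *)

Section Embedding.
Context {R : realType} {r : nat} {A : cstarAlgType R} {U V : A}.
Hypothesis hA : is_nc_torus (tpar R r ^+ 2) U V.

Local Notation t := (tpar R r).
Local Notation w := (weyl t U V).
Implicit Types (s : seq (R[i] * (int * int))) (f g : obs R r).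

Definition weyl_sum (s : seq (R[i] * (int * int))) : A :=
  \sum_(i <- s) i.1 *: (w i.2 + w (- i.2)).

Lemma lincombB s s' :
  lincomb r (s ++ [seq (- i.1, i.2) | i <- s']) = lincomb r s - lincomb r s'.
Proof.
rewrite /lincomb big_cat big_map /= -sumrN; congr (_ + _).
by apply: eq_bigr => i _; rewrite scaleNr.
Qed.

Lemma weyl_sumB s s' :
  weyl_sum (s ++ [seq (- i.1, i.2) | i <- s']) = weyl_sum s - weyl_sum s'.
Proof.
rewrite /weyl_sum big_cat big_map /= -sumrN; congr (_ + _).
by apply: eq_bigr => i _; rewrite scaleNr.
Qed.

(** The forward direction makes the map well defined, the backward one makes it injective; each
    transfers relations out of one of the two weight families. *)
Lemma weyl_sum_eq0 s : lincomb r s = 0 <-> weyl_sum s = 0.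
Proof.
split=> [/lincomb_eq0 /(weight_even_relation w _ plane_character_weight) //|].
move/(weight_even_relation (obsC_pair R r) _ (weyl_weight (tpar_neq0 R r) hA)).
(* Since [obsC_pair] is even, the transferred relation is twice the wanted one. *)
under eq_bigr do rewrite obsC_pairN -mulr2n -scaler_nat scalerA mulrC -scalerA.
rewrite -scaler_sumr => /eqP; rewrite scaler_eq0 pnatr_eq0 /= => /eqP; exact.
Qed.

(** The expansion is the one picked by [coords]; [embedE] shows that any other gives the same
    value. *)
Definition embed (f : obs R r) : A := weyl_sum (coords f).

Lemma embedE s : embed (lincomb r s) = weyl_sum s.
Proof.
apply/eqP; rewrite -subr_eq0 -weyl_sumB; apply/eqP/weyl_sum_eq0.
by rewrite lincombB coordsK subrr.
Qed.

Lemma embed_inj : injective embed.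
Proof.
move=> f g /eqP; rewrite -subr_eq0 -weyl_sumB => /eqP/weyl_sum_eq0.
by rewrite lincombB !coordsK => /eqP; rewrite subr_eq0 => /eqP.
Qed.

Lemma embed_linear : linear embed.
Proof.
move=> k f g; rewrite -[f]coordsK -[g]coordsK.
have -> : k *: lincomb r (coords f) + lincomb r (coords g) =
    lincomb r ([seq (k * i.1, i.2) | i <- coords f] ++ coords g).
  rewrite /lincomb big_cat big_map /= scaler_sumr; congr (_ + _).
  by apply: eq_bigr => i _; rewrite scalerA.
rewrite !embedE /weyl_sum big_cat big_map /= scaler_sumr; congr (_ + _).
by apply: eq_bigr => i _; rewrite scalerA.
Qed.

Let embed_lin : {linear obs R r -> A} :=
  HB.pack embed (GRing.isLinear.Build _ _ _ _ embed embed_linear).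

Let embed0 : embed 0 = 0. Proof. exact: (linear0 embed_lin). Qed.

Let embedD f g : embed (f + g) = embed f + embed g.
Proof. exact: (linearD embed_lin). Qed.

Let embedZ k f : embed (k *: f) = k *: embed f.
Proof. by rewrite -[k *: f]addr0 embed_linear embed0 addr0. Qed.

Lemma embed_obsC a : embed (obsC_pair R r a) = w a + w (- a).
Proof.
have -> : obsC_pair R r a = lincomb r [:: (1, a)] by rewrite /lincomb big_seq1 scale1r.
by rewrite embedE /weyl_sum big_seq1 scale1r.
Qed.

Lemma embed_monoid_morphism : monoid_morphism embed.
Proof.
split.
  (* The unit is half of C(0,0), whose image is [weyl 0 + weyl 0], twice the unit of [A]. *)
  rewrite -[1]/(obs1 R r) /obs1 embedZ /= embed_obsC oppr0 weyl0.
  by rewrite -mulr2n -[X in _ *: X]scaler_nat scalerA mulVf ?scale1r // pnatr_eq0.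
(* Both sides are bilinear, so two inductions reduce to generators, where [weyl_evenM] matches the
   star product. *)
move=> f g; elim/obs_ind: f => [|k a f IHf]; first by rewrite mul0r embed0 mul0r.
rewrite mulrDl !embedD mulrDl IHf -scalerAl !embedZ -scalerAl /=.
congr (_ *: _ + _); elim/obs_ind: g {IHf} => [|k' b g IHg].
  by rewrite mulr0 embed0 mulr0.
rewrite mulrDr !embedD mulrDr IHg -scalerAr !embedZ -scalerAr /=.
congr (_ *: _ + _); rewrite -[_ * _]/(star _ _) star_obsC /starC.
rewrite embedD !embedZ /= !embed_obsC weyl_evenM //; first exact: tpar_neq0.
by case: hA.
Qed.

Definition embedding : {lrmorphism obs R r -> A} :=
  HB.pack embed (GRing.isLinear.Build _ _ _ _ embed embed_linear)
    (GRing.isMonoidMorphism.Build _ _ embed embed_monoid_morphism).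

End Embedding.

Theorem mainTheorem2 (R : realType) (r : nat) (hr : (3 <= r)%N)
    (A : cstarAlgType R) (U V : A) (hA : is_nc_torus (tpar R r ^+ 2) U V) :
  exists Phi : {lrmorphism obs R r -> A},
    [/\ forall p q : int, Phi (obsC R r p q) =
          tpar R r ^ (- (p * q)) *:
            (upow U p * upow V q + upow U (- p) * upow V (- q)),
        forall L : {linear obs R r -> A},
          (forall p q : int, L (obsC R r p q) =
             tpar R r ^ (- (p * q)) *:
               (upow U p * upow V q + upow U (- p) * upow V (- q))) ->
          L =1 Phi,
        injective Phi &
        exists2 S : {pred A}, subalg_closed S &
          forall y : A, y \in S <-> exists x : obs R r, Phi x = y].
Proof.
pose Phi := embedding hA.
exists Phi; split.
(* As [(-p)(-q) = pq], both monomials carry the same normalizing power of [t]. *)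
- move=> p q; rewrite /Phi /= (embed_obsC hA) /weyl /= mulrNN.
  by rewrite scalerDr.
- move=> L LE f; elim/obs_ind: f => [|k [p q] f IHf]; first by rewrite !linear0.
  by rewrite !linearD !linearZ IHf LE /Phi /= (embed_obsC hA) /weyl /= mulrNN scalerDr.
- exact: embed_inj hA.
- exists (fun y => `[< exists x, Phi x = y >]) => [|y]; last first.
    by split=> [/asboolP|?] //; exact/asboolP.
  split; first by apply/asboolP; exists 1; rewrite rmorph1.
    move=> k _ _ /asboolP[x <-] /asboolP[y <-]; apply/asboolP.
    by exists (k *: x + y); rewrite linearP.
  move=> _ _ /asboolP[x <-] /asboolP[y <-]; apply/asboolP.
  by exists (x * y); rewrite rmorphM.
Qed.
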